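(* For integers $r,n\ge 0$ let $f_r(n)$ denote the number of permutations in $S_n$ that avoid the generalized pattern $12\text{-}3$ and contain exactly $r$ occurrences of the generalized pattern $31\text{-}2$. Then for every integer $r\ge 0$ there is a polynomial $P$ with rational coefficients, of degree at most $2r+2$, such that $f_r(n)=P(n)$ for all $n\ge 0$.
   Context: $S_n$ is the set of permutations $\pi=\pi_1\pi_2\cdots\pi_n$ of $\{1,\dots,n\}$; $S_0$ consists of the empty permutation only. An occurrence of a generalized pattern $ab\text{-}c$ (with $abc$ a permutation of $\{1,2,3\}$) in $\pi$ is a pair $(i,j)$ with $i+1<j\le n$ such that $(\pi_i,\pi_{i+1},\pi_j)$ is order-isomorphic to $(a,b,c)$ (so the first two letters are adjacent in $\pi$). $\pi$ avoids the pattern if it has no occurrence of it. *)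

(* Defs.v *)
From mathcomp Require Import all_boot all_order all_fingroup all_algebra.

Set Implicit Arguments.
Unset Strict Implicit.
Unset Printing Implicit Defensive.

Definition order_isomorphic (s t : seq nat) : bool :=
  (size s == size t) &&
  [forall k : 'I_(size s), forall l : 'I_(size s),
     (nth 0 s k < nth 0 s l) == (nth 0 t k < nth 0 t l)].

(* The word pi_1 pi_2 ... pi_n. Permutations act on {0, ..., n-1} here, so
   the letters are shifted to {1, ..., n}. *)
Definition one_line (n : nat) (pi : 'S_n) : seq nat :=
  [seq (val (pi i)).+1 | i <- enum 'I_n].

(* Positions i and j are 0-based. *)
Definition occurs_at (a b c : nat) (w : seq nat) (i j : nat) : bool :=
  (i.+1 < j) &&
  order_isomorphic [:: nth 0 w i; nth 0 w i.+1; nth 0 w j] [:: a; b; c].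

Definition occurrences (a b c : nat) (n : nat) (pi : 'S_n) :
    {set 'I_n * 'I_n} :=
  [set ij : 'I_n * 'I_n | occurs_at a b c (one_line pi) ij.1 ij.2].

Definition avoids (a b c : nat) (n : nat) (pi : 'S_n) : bool :=
  occurrences a b c pi == set0.

Definition f (r n : nat) : nat :=
  #|[set pi : 'S_n | avoids 1 2 3 pi & #|occurrences 3 1 2 pi| == r]|.

(* Main.v *)
(* Classify the permutations of length n by the number of letters larger than
   the first one. Prepending a letter with j larger ones to a permutation whose
   first letter has i larger ones creates i - j occurrences of 31-2 and none of
   12-3 if j <= i, and i occurrences of 12-3 and none of 31-2 if i < j. Hence,
   if b_n(j) is the generating function in q of the 31-2 occurrences over the
   12-3-avoiders with j letters above the first one,
     b_(n+1)(j) = S_n(j) + [1 <= j <= n] b_n(0),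
     S_n(j) = sum_(i >= j) q^(i-j) b_n(i) = b_n(j) + q S_n(j+1).
   Eliminating b expresses the first differences in n of S_n(0), of S_(k+n)(k)
   and of the tails of sum_j S_n(j) by the same quantities with lower powers of
   q, and induction on that power shows that their coefficients are combinations
   of binomials 'C(n, k) with k bounded. *)
Require Import Defs.
From mathcomp Require Import all_boot all_order all_fingroup all_algebra zify.

Set Implicit Arguments.
Unset Strict Implicit.
Unset Printing Implicit Defensive.

(** * Counting pattern occurrences along a word *)

(** Recursion on the word isolates the occurrences that start at a prepended letter. The default in
    [head 0 v] is never compared: if [v] is empty, so is [behead v]. *)
Fixpoint occ (a b c : nat) (w : seq nat) : nat :=
  if w is x :: v then
    count (fun z => order_isomorphic [:: x; head 0 v; z] [:: a; b; c])
          (behead v) + occ a b c v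
  else 0.

Lemma occE (a b c : nat) (w : seq nat) :
  \sum_(i < size w) \sum_(j < size w) occurs_at a b c w i j = occ a b c w.
Proof.
elim: w => [|x v IHv]; first by rewrite big_ord0.
rewrite /= big_ord_recl /= -IHv; congr (_ + _); last first.
  by apply: eq_bigr => i _; rewrite big_ord_recl.
rewrite big_ord_recl add0n.
case: v {IHv} => [|y u] /=; first by rewrite big_ord0.
rewrite big_ord_recl add0n -sum1_count (big_nth 0) big_mkord [RHS]big_mkcond.
by apply: eq_bigr => j _; rewrite /occurs_at /=; case: order_isomorphic.
Qed.

Lemma size_one_line (n : nat) (pi : 'S_n) : size (one_line pi) = n.
Proof. by rewrite size_map size_enum_ord. Qed.

Lemma card_occurrences (a b c n : nat) (pi : 'S_n) :
  #|occurrences a b c pi| = occ a b c (one_line pi).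
Proof.
rewrite -occE size_one_line pair_big /= -sum1dep_card big_mkcond.
by apply: eq_bigr => ij _; case: occurs_at.
Qed.

Lemma order_isomorphic3 (x y z a b c : nat) :
  order_isomorphic [:: x; y; z] [:: a; b; c] =
  [&& (x < y) == (a < b), (x < z) == (a < c), (y < z) == (b < c),
      (y < x) == (b < a), (z < x) == (c < a) & (z < y) == (c < b)].
Proof.
apply/idP/idP => [/andP[_ /'forall_forallP H] | H].
  have iso (i j : nat) (lt_i3 : i < 3) (lt_j3 : j < 3) :=
    H (Ordinal lt_i3) (Ordinal lt_j3).
  by rewrite (iso 0 1) ?(iso 0 2) ?(iso 1 2) ?(iso 1 0) ?(iso 2 0) ?(iso 2 1).
case/and5P: H => e01 e02 e12 e10 /andP[e20 e21].
apply/andP; split=> //; apply/'forall_forallP.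
by case=> [[|[|[|//]]] ?] [[|[|[|//]]] ?] //=; rewrite !ltnn.
Qed.

Lemma order_isomorphic123 (x y z : nat) :
  order_isomorphic [:: x; y; z] [:: 1; 2; 3] = (x < y < z).
Proof. rewrite order_isomorphic3 /=; lia. Qed.

Lemma order_isomorphic312 (x y z : nat) :
  order_isomorphic [:: x; y; z] [:: 3; 1; 2] = (y < z < x).
Proof. rewrite order_isomorphic3 /=; lia. Qed.

(** [bump h] is strictly increasing, so making room for a new letter changes no pattern. *)
Lemma occ_bump (a b c h : nat) (w : seq nat) :
  occ a b c (map (bump h) w) = occ a b c w.
Proof.
elim: w => [|x [|y u] IHw] //.
rewrite [LHS]/= [RHS]/=; congr (_ + _); last exact: IHw.
rewrite count_map; apply: eq_count => z /=.
by rewrite !order_isomorphic3 ![bump _ _ < _]ltnNge !leq_bump2 -!ltnNge.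
Qed.

Lemma perm_one_line (n : nat) (pi : 'S_n) : perm_eq (one_line pi) (iota 1 n).
Proof.
rewrite /one_line (map_comp S (fun i => val (pi i))) (map_comp val pi).
rewrite -(addn0 1) iotaDl (eq_map (add1n)) -val_enum_ord !perm_map //.
apply: uniq_perm; rewrite ?enum_uniq ?(map_inj_uniq perm_inj) ?enum_uniq //.
move=> i; rewrite mem_enum; apply/mapP; exists (pi^-1 i)%g.
  by rewrite mem_enum.
by rewrite permKV.
Qed.

Lemma count_iota_itv (a b n : nat) :
  b <= n.+1 -> count (fun z => a < z < b) (iota 1 n) = b - a.+1.
Proof.
move=> le_bn.
elim: n b le_bn => [|n IHn] b le_bn; first by rewrite /=; lia.
rewrite -[n.+1]addn1 iotaD count_cat /= addn0 add1n.
case: (ltnP n.+1 b) => h; last by rewrite IHn //; lia.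
(* Here [b = n.+2]; lowering the bound to [n.+1] loses no letter of [iota 1 n] and fits the
   induction hypothesis. *)
rewrite (@eq_in_count _ _ (fun z => a < z < n.+1)); last first.
  by move=> z; rewrite mem_iota; lia.
rewrite IHn //; lia.
Qed.

(** * Prepending a letter to a permutation *)

Lemma one_line_lift_perm (n : nat) (x : 'I_n.+1) (s : 'S_n) :
  one_line (lift_perm ord0 x s) = x.+1 :: map (bump x.+1) (one_line s).
Proof.
rewrite /one_line enum_ordSl /= lift_perm_id -!map_comp; congr (_ :: _).
by apply: eq_map => i /=; rewrite lift_perm_lift bumpS.
Qed.

Lemma lift_perm_bij (n : nat) :
  bijective (fun xs : 'I_n.+1 * 'S_n => lift_perm ord0 xs.1 xs.2).
Proof.
apply: inj_card_bij => [[x s] [y t] /= e|]; last first.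
  by rewrite card_prod card_ord !card_Sn factS.
have exy : x = y by rewrite -(lift_perm_id ord0 x s) e lift_perm_id.
rewrite {}exy in e *; congr (_, _); apply/permP => i.
by apply: (@lift_inj _ y); rewrite -!(lift_perm_lift ord0) e.
Qed.

Definition above_first (n : nat) (pi : 'S_n) : nat := n - head 0 (one_line pi).

Lemma above_first_lift_perm (n : nat) (x : 'I_n.+1) (s : 'S_n) :
  above_first (lift_perm ord0 x s) = n - x.
Proof. by rewrite /above_first one_line_lift_perm /= subSS. Qed.

Lemma one_line_cons (n : nat) (s : 'S_n) :
  0 < n -> exists y u, one_line s = y :: u /\ 0 < y <= n.
Proof.
move=> n_gt0; case E: (one_line s) => [|y u].
  by rewrite -(size_one_line s) E in n_gt0.
exists y, u; split=> //.
have : y \in one_line s by rewrite E mem_head.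
by rewrite (perm_mem (perm_one_line s)) mem_iota add1n ltnS.
Qed.

Lemma above_first_lt (n : nat) (s : 'S_n) : 0 < n -> above_first s < n.
Proof.
move=> n_gt0; have [y [u [E y_itv]]] := one_line_cons s n_gt0.
rewrite /above_first E /=; lia.
Qed.

Lemma occ123_lift_perm (n : nat) (x : 'I_n.+1) (s : 'S_n) :
  occ 1 2 3 (one_line (lift_perm ord0 x s)) =
  (if above_first s < n - x then above_first s else 0) +
  occ 1 2 3 (one_line s).
Proof.
have [n0|n_gt0] := posnP n; first by subst n; rewrite ord1 one_line_lift_perm
  /above_first /= (size0nil (size_one_line s)) /=.
have [y [u [E y_itv]]] := one_line_cons s n_gt0.
have perm_w := seq.permP (perm_one_line (lift_perm ord0 x s)).
rewrite one_line_lift_perm E in perm_w *.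
rewrite -(occ_bump 1 2 3 x.+1 (y :: u)) /above_first E [LHS]/= [RHS]/=.
congr (_ + _).
set y' := bump _ _ in perm_w *.
rewrite (eq_count (order_isomorphic123 _ _)).
have [lt_xy|le_yx] := ltnP x.+1 y'; last first.
  rewrite (eq_count (a2 := pred0)) ?count_pred0 => [|z //].
  by move: le_yx; rewrite /y' /bump; case: ifP; lia.
(* Neither of the first two letters exceeds [y'], so the count over [u] is a count over all letters
   [1, ..., n.+1]; the upper bound only gives it interval form. *)
have := perm_w (fun z => y' < z < n.+2).
rewrite (@count_iota_itv y' n.+2 n.+1) //= ltnn !add0n.
rewrite (leq_gtF (ltnW lt_xy)) add0n => e.
rewrite -[LHS](@eq_in_count _ (fun z => y' < z < n.+2)) => [|z z_u].
  rewrite e; move: lt_xy; rewrite /y' /bump; case: ifP; lia.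
suff: z \in iota 1 n.+1 by rewrite mem_iota; lia.
rewrite -(perm_mem (perm_one_line (lift_perm ord0 x s))) one_line_lift_perm E.
by rewrite !inE z_u !orbT.
Qed.

Lemma occ312_lift_perm (n : nat) (x : 'I_n.+1) (s : 'S_n) :
  occ 3 1 2 (one_line (lift_perm ord0 x s)) =
  (above_first s - (n - x)) + occ 3 1 2 (one_line s).
Proof.
have [n0|n_gt0] := posnP n; first by subst n; rewrite ord1 one_line_lift_perm
  /above_first /= (size0nil (size_one_line s)) /=.
have [y [u [E y_itv]]] := one_line_cons s n_gt0.
have perm_w := seq.permP (perm_one_line (lift_perm ord0 x s)).
rewrite one_line_lift_perm E in perm_w *.
rewrite -(occ_bump 3 1 2 x.+1 (y :: u)) /above_first E [LHS]/= [RHS]/=.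
congr (_ + _).
rewrite (eq_count (order_isomorphic312 _ _)).
(* The two endpoints are the first two letters, so they add nothing to the count over the whole
   word. If the second letter is larger, the interval is empty and the subtraction truncates to
   0. *)
have := perm_w (fun z => bump x.+1 y < z < x.+1).
rewrite (@count_iota_itv _ x.+1 n.+1) ?(leqW (ltn_ord x)) //=.
rewrite !ltnn andbF !add0n => ->.
have := ltn_ord x; rewrite /bump; lia.
Qed.

(** * Counts refined by the first letter, and their recurrence *)

Definition refined_count (n r j : nat) : nat :=
  #|[set pi : 'S_n | [&& occ 1 2 3 (one_line pi) == 0,
                         occ 3 1 2 (one_line pi) == r & above_first pi == j]]|.

Lemma refined_countE (n r j : nat) : refined_count n r j =
  \sum_(pi : 'S_n) [&& occ 1 2 3 (one_line pi) == 0,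
                       occ 3 1 2 (one_line pi) == r & above_first pi == j].
Proof.
rewrite /refined_count -sum1dep_card big_mkcond /=.
by apply: eq_bigr => pi _; case: [&& _, _ & _].
Qed.

Lemma refined_count0n (r j : nat) :
  refined_count 0 r j = (r == 0) && (j == 0).
Proof.
rewrite refined_countE (big_pred1 1%g) => [|s]; last first.
  by rewrite /= [s]permS0 eqxx.
rewrite (size0nil (size_one_line _)) /= /above_first.
by rewrite (eq_sym 0) sub0n (eq_sym 0).
Qed.

(** The condition [0 < j] excludes the empty permutation, for which [above_first] is 0 and equals
    [n]. *)
Lemma refined_count_small (n r j : nat) :
  0 < j -> n <= j -> refined_count n r j = 0.
Proof.
have [->|n_gt0] := posnP n => j_gt0 le_nj.
  by rewrite refined_count0n; case: j j_gt0 {le_nj} => //= j; rewrite andbF.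
apply/eqP; rewrite cards_eq0; apply/eqP/setP => s; rewrite !inE.
have := above_first_lt s n_gt0; lia.
Qed.

Lemma f_refined (r n : nat) : f r n = \sum_(j < n.+1) refined_count n r j.
Proof.
rewrite /f -sum1dep_card big_mkcond.
under [RHS]eq_bigr do rewrite refined_countE.
rewrite exchange_big /=; apply: eq_bigr => s _.
rewrite /avoids -cards_eq0 !card_occurrences.
have lt_sn : above_first s < n.+1 by rewrite ltnS leq_subr.
rewrite (bigD1 (Ordinal lt_sn)) //= eqxx andbT big1 => [|j ne_j].
  by rewrite addn0; case: (_ == 0); case: (_ == r).
rewrite (_ : above_first s == j = false) ?andbF //.
by apply/negbTE; move: ne_j; rewrite eq_sym.
Qed.

(* The coefficient of q^r in S_n(j). *)
Definition ray (n r j : nat) : nat :=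
  \sum_(i < r.+1) refined_count n (r - i) (j + i).

Lemma refined_countS (n r j : nat) : j <= n ->
  refined_count n.+1 r j = ray n r j + (0 < j) * refined_count n r 0.
Proof.
move=> le_jn; rewrite refined_countE (reindex _ (onW_bij _ (lift_perm_bij n))).
rewrite -(pair_bigA _ (fun x s =>
  [&& occ 1 2 3 (one_line (lift_perm ord0 x s)) == 0,
      occ 3 1 2 (one_line (lift_perm ord0 x s)) == r
    & above_first (lift_perm ord0 x s) == j] : nat)) /=.
(* [n - j] is the only 0-based first letter with [j] letters above it. *)
have lt_njn : n - j < n.+1 by rewrite ltnS leq_subr.
rewrite (bigD1 (Ordinal lt_njn)) //= [X in _ + X]big1 ?addn0; last first.
  move=> x /negbTE ne_x; apply: big1 => s _; rewrite above_first_lift_perm.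
  rewrite (_ : _ == j = false) ?andbF //; apply/negP => /eqP ej.
  suff : x == Ordinal lt_njn by rewrite ne_x.
  by rewrite -val_eqE /= -ej subKn // -ltnS.
rewrite /ray; under [X in _ = X + _]eq_bigr do rewrite refined_countE.
rewrite exchange_big refined_countE big_distrr -big_split /=.
apply: eq_bigr => s _.
rewrite occ123_lift_perm occ312_lift_perm above_first_lift_perm /= subKn //.
set o := occ 1 2 3 _; set p := occ 3 1 2 _; set a := above_first s.
(* At most one term survives, the one with [i = a - j]. The case [a < j] is left to the second
   summand, which requires [a = 0]. *)
have -> : \sum_(i < r.+1) [&& o == 0, p == r - i & a == j + i] =
          [&& o == 0, j <= a & a - j + p == r].
  have [/andP[le_ja lt_ar] | out] := boolP (j <= a < j + r.+1).
    have lt_ajr : a - j < r.+1 by lia.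
    rewrite (bigD1 (Ordinal lt_ajr)) //= big1 ?addn0; first by lia.
    by move=> i; rewrite -val_eqE /= => ne_i; lia.
  by rewrite big1 => [|i _]; have := out; try have := ltn_ord i; lia.
by case: ifP; lia.
Qed.

Lemma ray_rec (n r j : nat) : ray n r j =
  refined_count n r j + (if r is r'.+1 then ray n r' j.+1 else 0).
Proof.
rewrite /ray big_ord_recl subn0 addn0; congr (_ + _).
case: r => [|r]; first by rewrite big_ord0.
by apply: eq_bigr => i _; rewrite /= /bump add1n subSS addSnnS.
Qed.

Lemma ray_small (n r j : nat) : 0 < j -> n <= j -> ray n r j = 0.
Proof.
move=> j_gt0 le_nj; apply: big1 => i _.
by rewrite refined_count_small ?addn_gt0 ?j_gt0 // (leq_trans le_nj) ?leq_addr.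
Qed.

(** * First differences in the length *)

Lemma refined_countS0 (n r : nat) : refined_count n.+1 r 0 = ray n r 0.
Proof. by rewrite refined_countS // addn0. Qed.

Lemma ray0S (n r : nat) : ray n.+1 r 0 =
  ray n r 0 + (if r is r'.+1 then ray n.+1 r' 1 else 0).
Proof. by rewrite ray_rec refined_countS0. Qed.

(** Starting at length [k.+1] keeps [refined_countS] applicable for every [n]. The last term is the
    same kind of sequence, with [k] raised and [r] lowered. *)
Lemma ray_diagS (k r n : nat) : ray (k + n.+1).+1 r k.+1 =
  ray (k + n).+1 r k.+1 +
  (ray (k + n) r 0 + if r is r'.+1 then ray (k.+1 + n).+1 r' k.+2 else 0).
Proof.
rewrite ray_rec addnS refined_countS ?ltnS ?leq_addr // mul1n refined_countS0.
by rewrite addnA.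
Qed.

(** The coefficient of q^r in the sum of S_(k+n)(i) over all i > k: the terms with i >= k + n vanish
    by [ray_small]. *)
Definition ray_tail (k r n : nat) : nat :=
  \sum_(j < n) ray (k + n) r (k.+1 + j).

Lemma ray_tailS (k r n : nat) : ray_tail k r n.+1 =
  ray_tail k r n +
  (n * ray (k + n.-1) r 0 + if r is r'.+1 then ray_tail k.+1 r' n else 0).
Proof.
rewrite /ray_tail big_ord_recr /= [X in _ + X]ray_small ?addn0; first last.
- by rewrite addnS.
- by [].
under eq_bigr => j _.
  rewrite addnS ray_rec refined_countS ?mul1n; last first.
    by rewrite addSn ltn_add2l.
  over.
(* For [n = 0] the factor [n] cancels the term where [n.-1] truncates. *)
case: n => [|n]; first by case: r => [|r]; rewrite !big_ord0 mul0n.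
rewrite !big_split /= sum_nat_const card_ord addnA addnS refined_countS0.
congr (_ + _); case: r => [|r]; first by rewrite big1.
by apply: eq_bigr => j _; rewrite !addSn addnS.
Qed.

(** Expanding b_(n+1)(j) into b_n(j) + q S_n(j+1) + [j >= 1] b_n(0) and summing over j <= n makes
    [f r n] reappear; b_n(0) occurs [n] times. *)
Lemma fS (r n : nat) : f r n.+1 =
  f r n + (n * ray n.-1 r 0 + if r is r'.+1 then ray_tail 0 r' n else 0).
Proof.
rewrite !f_refined big_ord_recr /= [X in _ + X]refined_count_small // addn0.
under eq_bigr => j _ do rewrite refined_countS -1?ltnS // ray_rec.
rewrite !big_split /= -!addnA; congr (_ + _).
rewrite addnC -big_distrl /=; congr (_ + _).
  rewrite big_ord_recl add0n /= sum_nat_const card_ord muln1.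
  by case: n => // n; rewrite refined_countS0.
case: r => [|r]; first by rewrite big1.
rewrite big_ord_recr /= ray_small // addn0.
by apply: eq_bigr => j _; rewrite add1n.
Qed.

(** * Natural combinations of binomials of bounded lower index *)

Definition binomial_sum (d : nat) (g : nat -> nat) : Prop :=
  exists c : nat -> nat, forall n, g n = \sum_(k < d) c k * 'C(n, k).

Lemma binomial_sum0 (d : nat) : binomial_sum d (fun=> 0).
Proof. by exists (fun=> 0) => n; rewrite big1. Qed.

Lemma binomial_sum_widen (d e : nat) (g : nat -> nat) :
  d <= e -> binomial_sum d g -> binomial_sum e g.
Proof.
move=> le_de [c Ec]; exists (fun k => if k < d then c k else 0) => n.
rewrite Ec (big_ord_widen _ (fun k => c k * 'C(n, k)) le_de) big_mkcond.
by apply: eq_bigr => k _; case: ifP.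
Qed.

Lemma binomial_sumD (d : nat) (g h : nat -> nat) :
  binomial_sum d g -> binomial_sum d h -> binomial_sum d (fun n => g n + h n).
Proof.
move=> [b Eb] [c Ec]; exists (fun k => b k + c k) => n.
by rewrite Eb Ec -big_split; apply: eq_bigr => k _; rewrite mulnDl.
Qed.

Lemma binomial_sum_shift (m d : nat) (g : nat -> nat) :
  binomial_sum d g -> binomial_sum d (fun n => g (m + n)).
Proof.
elim: m => // m IHm /IHm [c Ec] {IHm}.
have [d0|d_gt0] := posnP d.
  by exists c => n; rewrite addSnnS Ec d0 !big_ord0.
(* Pascal's rule moves part of the coefficient at [k.+1] down to [k]. *)
exists (fun k => c k + (if k.+1 < d then c k.+1 else 0)) => n.
rewrite addSnnS Ec; under [RHS]eq_bigr do rewrite mulnDl.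
rewrite big_split /=; case: d d_gt0 {Ec} => // d _.
rewrite [X in _ + X]big_ord_recr /= ltnn mul0n addn0 !big_ord_recl !bin0.
rewrite -addnA; congr (_ + _); rewrite -big_split; apply: eq_bigr => k _.
by rewrite /= /bump add1n binS mulnDr ltnS ltn_ord.
Qed.

(** This rests on [n * 'C(n.-1, k) = k.+1 * 'C(n, k.+1)]. *)
Lemma binomial_sum_mul_pred (d : nat) (g : nat -> nat) :
  binomial_sum d g -> binomial_sum d.+1 (fun n => n * g n.-1).
Proof.
move=> [c Ec]; exists (fun k => k * c k.-1) => n.
rewrite Ec big_distrr big_ord_recl mul0n add0n; apply: eq_bigr => k _.
by rewrite /= /bump add1n mulnCA mul_bin_diag mulnCA mulnA.
Qed.

(** By Pascal's rule the difference of ['C(n, k.+1)] is ['C(n, k)], so summation shifts the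
    coefficients up by one and [g 0] becomes the constant term. *)
Lemma binomial_sum_antidiff (d : nat) (g h : nat -> nat) :
  (forall n, g n.+1 = g n + h n) -> binomial_sum d h -> binomial_sum d.+1 g.
Proof.
move=> Eg [c Ec]; exists (fun k => if k is k'.+1 then c k' else g 0) => n.
rewrite big_ord_recl bin0 muln1 /=; elim: n => [|n IHn].
  by rewrite big1 ?addn0 // => k _; rewrite bin0n muln0.
rewrite Eg IHn Ec -addnA -big_split; congr (_ + _); apply: eq_bigr => k _.
by rewrite /= /bump add1n binS mulnDr.
Qed.

(** * Degree bounds by induction on [r] *)

(** Each unit of [r] costs two summations: the diagonal for [r] at [k = 0] is summed to
    [ray n r.+1 0], which is summed to the diagonals for [r.+1]. All [k] are treated together
    because [ray_diagS] raises [k]. *)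
Lemma binomial_sum_ray_diag (r : nat) :
  binomial_sum (2 * r + 1) (fun n => ray n r 0) /\
  (forall k, binomial_sum (2 * r + 2) (fun n => ray (k + n).+1 r k.+1)).
Proof.
elim: r => [|r [IH0 IHk]].
  have H0 : binomial_sum 1 (fun n => ray n 0 0).
    apply: (@binomial_sum_antidiff 0 _ (fun=> 0)); last exact: binomial_sum0.
    by move=> n; rewrite ray0S.
  split=> // k.
  apply: (@binomial_sum_antidiff 1 _ (fun n => ray (k + n) 0 0 + 0)) => [n|].
    exact: ray_diagS.
  apply: binomial_sumD (binomial_sum0 1).
  exact: (binomial_sum_shift k H0).
have H0 : binomial_sum (2 * r.+1 + 1) (fun n => ray n r.+1 0).
  rewrite (_ : 2 * r.+1 + 1 = (2 * r + 2).+1); last by lia.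
  apply: binomial_sum_antidiff (IHk 0) => n; exact: ray0S.
split=> // k; rewrite addn2.
apply: (@binomial_sum_antidiff _ _
  (fun n => ray (k + n) r.+1 0 + ray (k.+1 + n).+1 r k.+2)) => [n|].
  exact: ray_diagS.
rewrite -addn1; apply: binomial_sumD; first exact: (binomial_sum_shift k H0).
by apply: binomial_sum_widen (IHk k.+1); lia.
Qed.

(** In [ray_tailS] the product with [n] dominates: its degree is at most 2r+1, and summation adds
    one. *)
Lemma binomial_sum_ray_tail (r k : nat) :
  binomial_sum (2 * r + 3) (ray_tail k r).
Proof.
elim: r k => [|r IHr] k.
  apply: (binomial_sum_antidiff (ray_tailS k 0)).
  apply: binomial_sumD (binomial_sum0 2).
  exact: (binomial_sum_mul_pred
            (binomial_sum_shift k (binomial_sum_ray_diag 0).1)).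
rewrite addn3; apply: (binomial_sum_antidiff (ray_tailS k r.+1)).
apply: binomial_sumD; last by apply: binomial_sum_widen (IHr k.+1); lia.
apply: (@binomial_sum_widen (2 * r.+1 + 1).+1); first by lia.
exact: (binomial_sum_mul_pred
          (binomial_sum_shift k (binomial_sum_ray_diag r.+1).1)).
Qed.

Lemma binomial_sum_f (r : nat) : binomial_sum (2 * r + 3) (f r).
Proof.
rewrite addn3; apply: (binomial_sum_antidiff (fS r)); apply: binomial_sumD.
  apply: (@binomial_sum_widen (2 * r + 1).+1); first by lia.
  exact: (binomial_sum_mul_pred (binomial_sum_ray_diag r).1).
case: r => [|r]; first exact: binomial_sum0.
by apply: binomial_sum_widen (binomial_sum_ray_tail r 0); lia.
Qed.

(** * From binomial sums to rational polynomials *)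

Import GRing.Theory Num.Theory.
Local Open Scope ring_scope.

Definition binomial_poly (k : nat) : {poly rat} :=
  (k`!%:R)^-1 *: \prod_(i < k) ('X - i%:R%:P).

Lemma size_binomial_poly (k : nat) : (size (binomial_poly k) <= k.+1)%N.
Proof.
rewrite (leq_trans (size_scale_leq _ _)) // size_prod_XsubC.
by rewrite /index_enum -enumT size_enum_ord.
Qed.

Lemma horner_binomial_poly (k n : nat) : (binomial_poly k).[n%:R] = 'C(n, k)%:R.
Proof.
rewrite hornerZ horner_prod.
have fact_neq0 : (k`!)%:R != 0 :> rat by rewrite pnatr_eq0 -lt0n fact_gt0.
apply: (mulfI fact_neq0); rewrite mulVKf // -natrM mulnC bin_ffact.
under eq_bigr do rewrite hornerXsubC.
elim: k {fact_neq0} => [|k IHk]; first by rewrite big_ord0.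
rewrite ffactnSr natrM -IHk big_ord_recr /=; have [le_kn|lt_nk] := leqP k n.
  by rewrite natrB.
(* For [n < k] the truncated [n - k] differs from the rational difference, but both sides contain
   the zero factor at [i = n]. *)
by rewrite (bigD1 (Ordinal lt_nk)) //= subrr !mul0r.
Qed.

(* Degree at most 2r+2 means size at most 2r+3. *)
Theorem theorem2p14 (r : nat) :
  exists P : {poly rat},
    (size P <= 2 * r + 3)%N /\ forall n : nat, (f r n)%:R = P.[n%:R].
Proof.
have [c Ec] := binomial_sum_f r.
exists (\sum_(k < 2 * r + 3) (c k)%:R *: binomial_poly k); split=> [|n].
  apply: (leq_trans (size_sum _ _ _)); apply/bigmax_leqP => k _.
  apply: (leq_trans (size_scale_leq _ _)).
  exact: leq_trans (size_binomial_poly k) (ltn_ord k).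
rewrite Ec natr_sum horner_sum; apply: eq_bigr => k _.
by rewrite hornerZ horner_binomial_poly natrM.
Qed.
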